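(* Let $n\ge 1$ and let the unit cube $Q^n=[0,1]^n$ be covered by a finite family of closed sets $X_1,\ldots,X_N\subseteq Q^n$ with covering multiplicity at most $n$. Then there exist $i\in\{1,\ldots,N\}$ and $j\in\{1,\ldots,n\}$ such that $X_i$ intersects both opposite facets $\{x\in Q^n : x_j=0\}$ and $\{x\in Q^n : x_j=1\}$ of $Q^n$.
   Context: A family $\{X_i\}$ has covering multiplicity at most $m$ if no point belongs to more than $m$ of the sets $X_i$ (sets counted by index). *)

(* Defs.v *)
From mathcomp Require Import all_boot all_order all_algebra.
From mathcomp Require Import mathcomp_extra boolp classical_sets reals.
From mathcomp Require Import topology normedtype.

Set Implicit Arguments.
Unset Strict Implicit.
Unset Printing Implicit Defensive.

Import Order.TTheory GRing.Theory Num.Theory.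
Import numFieldNormedType.Exports.

Local Open Scope classical_set_scope.
Local Open Scope ring_scope.

(* R^n is 'rV[R]_n, whose library topology is the product topology. *)
Definition unit_cube (R : realType) (n : nat) : set 'rV[R]_n :=
  [set x | forall j : 'I_n, 0 <= x ord0 j <= 1].

(* Meant for b = 0 and b = 1. *)
Definition facet (R : realType) (n : nat) (j : 'I_n) (b : R) : set 'rV[R]_n :=
  [set x | unit_cube x /\ x ord0 j = b].

(* Indices are counted, so equal sets with distinct indices count separately. *)
Definition covering_multiplicity_le (I : finType) (T : Type)
    (X : I -> set T) (m : nat) : Prop :=
  forall x : T, (#|[pred i | x \in X i]| <= m)%N.

(* Main.v *)
Require Import Defs.
From mathcomp Require Import all_boot all_order all_algebra all_fingroup.
From mathcomp Require Import mathcomp_extra boolp classical_sets cardinality reals.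
From mathcomp Require Import interval_inference topology normedtype.

Set Implicit Arguments.
Unset Strict Implicit.
Unset Printing Implicit Defensive.

Import Order.TTheory GRing.Theory Num.Theory.
Import numFieldNormedType.Exports.

Local Open Scope classical_set_scope.
Local Open Scope ring_scope.

(** Suppose that no X_i meets two opposite facets.  Group the sets according to
    the first direction j such that X_i meets the facet x_j = 0, with an extra
    last class for the sets meeting none of these facets.  The unions of these
    n+1 classes form a closed cover as in Kuhn's cubical version of Sperner's
    lemma; applying that lemma to finer and finer grids, compactness yields a
    common point, which then lies in n+1 distinct X_i.

    Kuhn's lemma is proved by counting modulo 2 the simplices of Freudenthal's
    triangulation of a grid that carry all labels.  Over F_2 the indicator of
    such a simplex is the determinant of its 0/1 vertex-label incidence matrix;
    replacing the last column by the sum of all columns and expanding writes it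
    as a sum over the faces.  Faces interior to a grid cube cancel in pairs, the
    others telescope along a coordinate direction to the boundary of the grid,
    and there only the facet x_(n-1) = 0 contributes, with the count for
    dimension n-1. *)

(** * Sums over ['F_2], over permutations and over grid points *)

Lemma addF2 (x : 'F_2) : x + x = 0.
Proof. by apply: addrr_pchar2; exact: pchar_Fp. Qed.

Lemma signF2 n : (-1) ^+ n = 1 :> 'F_2.
Proof.
have -> : -1 = 1 :> 'F_2 by apply/val_inj.
exact: expr1n.
Qed.

Lemma sum_F2_telescope k (g : nat -> 'F_2) :
  \sum_(a < k) (g a.+1 + g a) = g k + g 0%N.
Proof.
elim: k => [|k IHk]; first by rewrite big_ord0 addF2.
by rewrite big_ord_recr /= IHk addrC -addrA (addrA (g k)) addF2 add0r.
Qed.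

(** Right multiplication by a transposition pairs even with odd permutations, so each value is
    counted twice. *)
Lemma sum_perm_tperm_eq0 (T : finType) (a b : T) (F : {perm T} -> 'F_2) :
  a != b -> (forall s, F (s * tperm a b)%g = F s) -> \sum_s F s = 0.
Proof.
move=> ab FE; rewrite (bigID (fun s : {perm T} => odd_perm s)) /=.
rewrite (reindex_inj (mulIg (tperm a b))) /=.
under eq_bigl do rewrite odd_permM odd_tperm ab addbT.
by under eq_bigr do rewrite FE; rewrite addF2.
Qed.

(** Used with [j = ord0] and [j = ord_max], to split by the coordinate raised first or last. *)
Lemma sum_lift_perm (V : nmodType) n (j : 'I_n.+1) (F : 'S_n.+1 -> V) :
  \sum_s F s = \sum_(d < n.+1) \sum_(t : 'S_n) F (lift_perm d j t).
Proof.
rewrite pair_big /=.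
rewrite (reindex (fun q : 'I_n.+1 * 'S_n => lift_perm q.1 j q.2)) //=.
apply/onW_bij/inj_card_bij => [[d s] [e t] /= eq_st|]; last first.
  by rewrite card_prod card_ord !card_Sn factS.
have eq_de : d = e.
  apply: (@perm_inj _ (lift_perm d j s)).
  by rewrite lift_perm_id {1}eq_st lift_perm_id.
subst e; congr (_, _); apply/permP => c; apply: (@lift_inj _ j).
by rewrite -!(lift_perm_lift d) eq_st.
Qed.

Definition insert_coord n (d : 'I_n.+1) (T : Type) (a : T) (x : 'I_n -> T)
    (c : 'I_n.+1) : T :=
  if unlift d c is Some c' then x c' else a.

Lemma insert_coord_id n (d : 'I_n.+1) (T : Type) (a : T) x :
  insert_coord d a x d = a.
Proof. by rewrite /insert_coord unlift_none. Qed.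

Lemma insert_coord_lift n (d : 'I_n.+1) (T : Type) (a : T) x c :
  insert_coord d a x (lift d c) = x c.
Proof. by rewrite /insert_coord liftK. Qed.

Lemma sum_insert_coord (V : nmodType) (T : finType) n (d : 'I_n.+1)
    (F : {ffun 'I_n.+1 -> T} -> V) :
  \sum_v F v
  = \sum_(w : {ffun 'I_n -> T}) \sum_(a : T) F [ffun c => insert_coord d a w c].
Proof.
rewrite pair_big /=.
rewrite (reindex
  (fun q : {ffun 'I_n -> T} * T => [ffun c => insert_coord d q.2 q.1 c])) //=.
exists (fun v => ([ffun c => v (lift d c)], v d)) => [[w a] _|v _] /=.
  congr (_, _); last by rewrite ffunE insert_coord_id.
  by apply/ffunP => c; rewrite !ffunE insert_coord_lift.
apply/ffunP => c; rewrite ffunE.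
case: (unliftP d c) => [c'|] ->; first by rewrite insert_coord_lift ffunE.
by rewrite insert_coord_id.
Qed.

(** * Parity of the number of fully labelled simplices *)

(** A label outside ['I_m] gives a zero row, so the determinant is 1 exactly when [l] is a bijection
    onto the labels below [m]. *)
Definition label_mx m (l : 'I_m -> nat) : 'M['F_2]_m :=
  \matrix_(i, j) (l i == j)%:R.

Lemma det_label_mx_surj m (l : 'I_m -> nat) (j : 'I_m) :
  \det (label_mx l) != 0 -> exists i, l i = j.
Proof.
apply: contraNP => /forallNP lNj; rewrite (expand_det_col _ j) big1 // => i _.
by rewrite mxE; have /eqP/negbTE -> := lNj i; rewrite mul0r.
Qed.

Lemma det_label_mx_boundary m (l : 'I_m.+1 -> nat) :
  (forall i, (l i <= m)%N) ->
  \det (label_mx l) = \sum_i \det (label_mx (fun j => l (lift i j))).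
Proof.
(* Multiplying by [E] replaces the last column by the sum of all columns, which
   is constant 1 since each row contains a single 1. *)
move=> lm.
pose E : 'M['F_2]_m.+1 := \matrix_(i, j) ((i == j) || (j == ord_max))%:R.
have detE : \det E = 1.
  rewrite -det_tr det_trig; last first.
    apply/is_trig_mxP => i j ij; rewrite !mxE.
    case: eqP ij => [-> | _]; first by rewrite ltnn.
    case: eqP => [->|//]; by rewrite ltnNge -ltnS ltn_ord.
  by rewrite big1 // => i _; rewrite !mxE eqxx.
have ME i j : (label_mx l *m E) i j = ((l i == j) || (j == ord_max))%:R.
  have li : (l i < m.+1)%N by rewrite ltnS.
  rewrite mxE (bigD1 (Ordinal li)) //= big1 ?addr0.
    by rewrite !mxE eqxx mul1r -val_eqE.
  by move=> c; rewrite -val_eqE eq_sym /= => /negbTE lic; rewrite !mxE lic mul0r.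
rewrite -[LHS]mulr1 -detE -det_mulmx (expand_det_col _ ord_max).
apply: eq_bigr => i _; rewrite ME eqxx orbT mul1r /cofactor signF2 mul1r.
congr (\det _); apply/matrixP => a b; rewrite 2![LHS]mxE [RHS]mxE ME.
by rewrite lift_max [_ == ord_max]eq_sym (negbTE (neq_lift _ _)) orbF.
Qed.

(* The vertices of the simplex of Freudenthal's triangulation with base point
   [v], where [s c] is the step at which coordinate [c] is raised. *)
Definition freudenthal n (v : 'I_n -> nat) (s : 'S_n) (i : nat) :
    'I_n -> nat :=
  fun c => (v c + (s c < i))%N.

Definition rainbow_count n k (lab : ('I_n -> nat) -> nat) : 'F_2 :=
  \sum_(v : {ffun 'I_n -> 'I_k}) \sum_(s : 'S_n)
    \det (label_mx (fun i : 'I_n.+1 => lab (freudenthal (fun c => v c) s i))).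

(** For the last coordinate [c], the bound on [x c = 0] excludes the label [n], which lets the
    labelling restrict to dimension [n - 1]. *)
Definition kuhn_labelling n k (lab : ('I_n -> nat) -> nat) : Prop :=
  forall x : 'I_n -> nat, (forall c, (x c <= k)%N) ->
    (lab x <= n)%N /\
    forall c, (x c = 0 -> lab x <= c)%N /\ (x c = k -> lab x <> c).

Lemma freudenthal_le n k (v : 'I_n -> 'I_k) s i c :
  (freudenthal (fun c => v c) s i c <= k)%N.
Proof.
rewrite /freudenthal; case: (s c < i)%N; rewrite ?addn1 ?addn0 ?ltn_ord //.
exact: ltnW (ltn_ord _).
Qed.

(** The face omitting vertex [i + 1] does not see the order of the steps [i] and [i + 1]; swapping
    them pairs the simplices sharing it. *)
Lemma inner_face_cancel n (v : 'I_n.+1 -> nat) (i : 'I_n)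
    (lab : ('I_n.+1 -> nat) -> nat) :
  \sum_(s : 'S_n.+1)
    \det (label_mx (fun t : 'I_n.+1 => lab (freudenthal v s
      (lift (lift ord0 (widen_ord (leqnSn n) i)) t)))) = 0.
Proof.
pose a : 'I_n.+1 := widen_ord (leqnSn n) i; pose b : 'I_n.+1 := lift ord0 i.
apply: (@sum_perm_tperm_eq0 _ a b).
  by rewrite -val_eqE /= /bump add1n neq_ltn ltnSn.
move=> s; congr (\det _); apply/matrixP => t j; rewrite !mxE.
congr ((lab _ == _)%:R); apply/funext => c; rewrite /freudenthal permM.
have tN : (bump i.+1 t == i.+1)%N = false.
  by rewrite eq_sym; apply/negbTE/neq_bump.
congr (_ + nat_of_bool _)%N.
have lt_ab : (a < bump i.+1 t = (b < bump i.+1 t))%N.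
  by rewrite /= /bump add1n leq_eqVlt eq_sym -/(bump i.+1 t) tN.
have -> : lift (lift ord0 (widen_ord (leqnSn n) i)) t = bump i.+1 t :> nat by [].
by case: tpermP => [->|->|//]; rewrite ?lt_ab.
Qed.

Lemma rainbow_countS n k (lab : ('I_n.+1 -> nat) -> nat) :
  kuhn_labelling k lab -> (0 < k)%N ->
  rainbow_count k lab =
  rainbow_count k (fun x => lab (insert_coord ord_max 0%N x)).
Proof.
move=> labP k0.
(* Indicator of a fully labelled face in the hyperplane [x d = a]. *)
pose G d a (t : 'S_n) (w : {ffun 'I_n -> 'I_k}) :=
  \det (label_mx (fun i : 'I_n.+1 =>
          lab (insert_coord d a (freudenthal (fun c => w c) t i)))).
have Gok d a t (w : {ffun 'I_n -> 'I_k}) i : (a <= k)%N ->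
    forall c, (insert_coord d a (freudenthal (fun c => w c) t i) c <= k)%N.
  move=> ak c; case: (unliftP d c) => [c'|] ->.
    by rewrite insert_coord_lift; exact: freudenthal_le.
  by rewrite insert_coord_id.
rewrite /rainbow_count.
pose face s (v : {ffun 'I_n.+1 -> 'I_k}) (i : 'I_n.+2) :=
  \det (label_mx (fun t : 'I_n.+1 =>
          lab (freudenthal (fun c => v c) s (lift i t)))).
transitivity (\sum_(v : {ffun 'I_n.+1 -> 'I_k}) \sum_(s : 'S_n.+1)
   (face s v ord0 + face s v ord_max)).
  apply: eq_bigr => v _.
  transitivity (\sum_(s : 'S_n.+1) (face s v ord0 + face s v ord_max +
      \sum_(i < n) face s v (lift ord0 (widen_ord (leqnSn n) i)))).
    apply: eq_bigr => s _; rewrite det_label_mx_boundary; last first.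
      by move=> i; case: (labP _ (freudenthal_le v s i)).
    have lift0_max : lift ord0 ord_max = ord_max :> 'I_n.+2 by exact/val_inj.
    rewrite big_ord_recl big_ord_recr -addrA; congr (_ + _).
    by rewrite addrC lift0_max.
  rewrite big_split /= [X in _ + X]exchange_big /= [X in _ + X]big1 ?addr0 // => i _.
  exact: inner_face_cancel.
(* Omitting vertex 0 leaves a face in [x d = v d + 1], with [d] raised first; omitting the last one
   leaves a face in [x d = v d], with [d] raised last. *)
have faceE (v : {ffun 'I_n.+1 -> 'I_k}) :
    \sum_(s : 'S_n.+1) (face s v ord0 + face s v ord_max) =
    \sum_(d < n.+1) \sum_(t : 'S_n)
      (G d (v d).+1 t [ffun c => v (lift d c)] +
       G d (v d) t [ffun c => v (lift d c)]).
  rewrite big_split /= (sum_lift_perm ord0) [X in _ + X](sum_lift_perm ord_max).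
  rewrite -big_split /=; apply: eq_bigr => d _; rewrite -big_split /=.
  apply: eq_bigr => t _; congr (_ + _);
    congr (\det _); apply/matrixP => i j; rewrite !mxE;
    congr ((lab _ == _)%:R); apply/funext => c; rewrite /freudenthal;
    case: (unliftP d c) => [c'|] ->;
    rewrite ?insert_coord_lift ?insert_coord_id;
    rewrite ?lift_perm_lift ?lift_perm_id ?ffunE //.
  - by rewrite /= /bump /= addn1.
  - by rewrite !lift_max.
  - by rewrite lift_max /= ltnNge -ltnS ltn_ord addn0.
under eq_bigr do rewrite faceE.
rewrite exchange_big /=.
transitivity (\sum_(d < n.+1) \sum_(t : 'S_n) \sum_(w : {ffun 'I_n -> 'I_k})
   (G d k t w + G d 0%N t w)).
  apply: eq_bigr => d _; rewrite exchange_big /=; apply: eq_bigr => t _.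
  rewrite (sum_insert_coord d); apply: eq_bigr => w _.
  rewrite -(sum_F2_telescope k (fun a => G d a t w)).
  apply: eq_bigr => a _; rewrite ffunE insert_coord_id.
  congr (_ + _); congr (G _ _ _ _); apply/ffunP => c;
    by rewrite !ffunE insert_coord_lift.
(* The label [d] is forbidden on [x d = k]. *)
have Gk d t w : G d k t w = 0.
  apply/eqP/negP => /negP /(det_label_mx_surj d) [i].
  have [_ /(_ d)[_]] := labP _ (Gok d k t w i (leqnn k)).
  by rewrite insert_coord_id => /(_ erefl).
(* On [x d = 0] the labels are at most [d < n], so [n] is missing. *)
have G0 (d : 'I_n.+1) t w : d != ord_max -> G d 0%N t w = 0.
  move=> dN; apply/eqP/negP => /negP /(det_label_mx_surj ord_max) [i] /= lE.
  have [_ /(_ d)[+ _]] := labP _ (Gok d 0%N t w i (leq0n k)).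
  rewrite insert_coord_id => /(_ erefl); rewrite lE => nd.
  by case/negP: dN; rewrite -val_eqE eqn_leq nd -ltnS ltn_ord.
rewrite (bigD1 ord_max) //= [X in _ + X]big1 ?addr0; last first.
  move=> d dN; rewrite big1 // => t _; rewrite big1 // => w _.
  by rewrite Gk G0 // addr0.
rewrite exchange_big /=; apply: eq_bigr => w _; apply: eq_bigr => t _.
by rewrite Gk add0r.
Qed.

Lemma kuhn_labelling_restrict n k (lab : ('I_n.+1 -> nat) -> nat) :
  kuhn_labelling k lab ->
  kuhn_labelling k (fun x => lab (insert_coord ord_max 0%N x)).
Proof.
move=> labP x xk.
have xk' c : (insert_coord ord_max 0%N x c <= k)%N.
  case: (unliftP ord_max c) => [c'|] ->; first by rewrite insert_coord_lift.
  by rewrite insert_coord_id.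
have [_ H] := labP _ xk'; split.
  by have [+ _] := H ord_max; rewrite insert_coord_id => /(_ erefl).
by move=> c; have := H (lift ord_max c); rewrite insert_coord_lift lift_max.
Qed.

Lemma rainbow_count_odd n k (lab : ('I_n -> nat) -> nat) :
  (0 < k)%N -> kuhn_labelling k lab -> rainbow_count k lab = 1.
Proof.
move=> k0; elim: n lab => [|n IHn] lab labP; last first.
  by rewrite rainbow_countS // IHn //; exact: kuhn_labelling_restrict.
(* In dimension 0 the only simplex is a point, labelled 0. *)
pose v0 : {ffun 'I_0 -> 'I_k} := [ffun=> Ordinal k0].
rewrite /rainbow_count (big_pred1 v0); last first.
  by move=> v; apply/esym/eqP/ffunP => -[].
rewrite (big_pred1 1%g); last by move=> s; apply/esym/eqP/permP => -[].
rewrite det_mx11 mxE.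
have [|l0 _] := labP (freudenthal (fun c => v0 c) 1 (ord0 : 'I_1)); first by case.
by move: l0; rewrite leqn0 => ->.
Qed.

Lemma kuhn_lemma n k (lab : ('I_n -> nat) -> nat) :
  (0 < k)%N -> kuhn_labelling k lab ->
  exists (v : 'I_n -> 'I_k) (s : 'S_n), forall j : 'I_n.+1, exists i : 'I_n.+1,
    lab (freudenthal (fun c => v c) s i) = j.
Proof.
move=> k0 labP; apply: contrapT => noR.
have := rainbow_count_odd k0 labP.
rewrite /rainbow_count big1 => [/eqP|v _]; first by rewrite eq_sym oner_eq0.
rewrite big1 // => s _; apply/eqP/negP => /negP detN0; apply: noR.
by exists v, s => j; exact: det_label_mx_surj detN0.
Qed.

(** * Closed covers of the cube *)

Lemma kuhn_cover (R : realType) n (Y : 'I_n.+1 -> set 'rV[R]_n) :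
  (forall l, closed (Y l)) ->
  @unit_cube R n `<=` \bigcup_l Y l ->
  (forall l j x, Y l x -> facet j 0 x -> (l <= j)%N) ->
  (forall l j x, Y l x -> facet j 1 x -> l <> j :> nat) ->
  exists x, forall l, Y l x.
Proof.
move=> Yclosed Ycover Y0 Y1.
have /boolp.choice[f fP] (x : 'rV[R]_n) : exists l, unit_cube x -> Y l x.
  have [/Ycover[l _ Ylx]|xN] := pselect (unit_cube x); first by exists l.
  by exists ord0.
pose pt k (x : 'I_n -> nat) : 'rV[R]_n := \row_c ((x c)%:R / k.+1%:R).
have pt_cube k x : (forall c, (x c <= k.+1)%N) -> unit_cube (pt k x).
  move=> xk c; rewrite mxE divr_ge0 //=.
  by rewrite ler_pdivrMr ?ltr0n // mul1r ler_nat.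
(* [z k] is the base point of a fully labelled simplex in the grid of mesh [1 / (k + 1)]. *)
have /boolp.choice[z zP] (k : nat) : exists z : 'rV[R]_n, unit_cube z /\
    forall l, exists2 y, Y l y & forall c, `|z ord0 c - y ord0 c| <= k.+1%:R^-1.
  have [||v [s vsP]] := @kuhn_lemma n k.+1 (fun x => f (pt k x)) => //.
    move=> x xk; split=> [|c]; first by rewrite -ltnS.
    have cubex := pt_cube _ _ xk; have Yx := fP _ cubex.
    split=> xc; [apply: Y0 Yx _|apply: Y1 Yx _]; split=> //; rewrite mxE xc.
      by rewrite mul0r.
    by rewrite divff // pnatr_eq0.
  exists (pt k (fun c => v c)); split.
    by apply: pt_cube => c; rewrite ltnW.
  move=> l; have [i li] := vsP l.
  exists (pt k (freudenthal (fun c => v c) s i)).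
    have -> : l = f (pt k (freudenthal (fun c => v c) s i)) by exact/val_inj.
    by apply/fP/pt_cube => c; exact: freudenthal_le.
  move=> c; rewrite !mxE -mulrBl natrD opprD addNKr normrM normrN.
  rewrite !ger0_norm ?invr_ge0 // ler_piMl ?invr_ge0 //.
  by case: (_ < _)%N.
have cube_compact : compact (@unit_cube R n).
  have -> : @unit_cube R n = [set x | forall c, `[0, 1]%classic (x ord0 c)].
    by apply/seteqP; split=> x /= xP c; have := xP c; rewrite /= in_itv.
  by apply: (@rV_compact R n (fun=> `[0, 1]%classic)) => _; exact: segment_compact.
have z_cube : (z @ \oo) (@unit_cube R n).
  by exists 0%N => // k _ /=; case: (zP k).
(* A cluster point of [z] is adherent to every [Y l], hence lies in it. *)
have [p [_ pcl]] :=
  cube_compact _ (fmap_proper_filter z eventually_filter) z_cube.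
exists p => l; rewrite (closure_id (Y l)).1 // => B /nbhs_ballP[e e0 eB].
have e20 : 0 < e / 2 by rewrite divr_gt0.
pose A := [set x : 'rV[R]_n |
  exists2 y, Y l y & forall c, `|x ord0 c - y ord0 c| < e / 2].
have zA : (z @ \oo) A.
  apply: filterS (near_infty_natSinv_lt (PosNum e20)) => k ke.
  have [_ /(_ l)[y Yy zy]] := zP k; exists y => // c.
  exact: le_lt_trans (zy c) ke.
have [x [[y Yy xy] px]] := pcl A (ball p (e / 2)) zA (nbhsx_ballx p _ e20).
exists y; split=> //; apply: eB; split=> // i c; rewrite ord1.
have [_ /(_ ord0 c) pxc] := px.
rewrite (splitr e); apply: (ball_triangle pxc).
by rewrite -ball_normE /= xy.
Qed.

Theorem theorem4p1 (R : realType) (n N : nat) (X : 'I_N -> set 'rV[R]_n)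
    (n_ge1 : (1 <= n)%N)
    (X_closed : forall i, closed (X i))
    (X_sub : forall i, X i `<=` @unit_cube R n)
    (X_cover : @unit_cube R n `<=` \bigcup_(i in [set: 'I_N]) X i)
    (X_mult : covering_multiplicity_le X n) :
  exists (i : 'I_N) (j : 'I_n),
    X i `&` facet j 0 !=set0 /\ X i `&` facet j 1 !=set0.
Proof.
apply: contrapT => noX.
(* [find] gives [cl i = n] when [X i] meets no facet [x_j = 0]. *)
pose meets0 i (j : 'I_n) := `[< X i `&` facet j 0 !=set0 >].
pose cl i := find (meets0 i) (enum 'I_n).
have cl_le i : (cl i <= n)%N by rewrite -[leqRHS](size_enum_ord n) find_size.
pose Y (l : 'I_n.+1) := \bigcup_(i in [set i | cl i = l]) X i.
have [||||x xY] := @kuhn_cover R n Y.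
- by move=> l; apply: closed_bigcup => //; exact: finite_finset.
- move=> x /X_cover[i _ Xix].
  have cli : (cl i < n.+1)%N by rewrite ltnS.
  by exists (Ordinal cli) => //; exists i.
- move=> l j x [i /= <- Xix] xj; rewrite leqNgt; apply/negP => jl.
  have := before_find j jl; rewrite nth_ord_enum => /negbT/asboolPn; apply.
  by exists x.
(* If [cl i = j], then [X i] meets [x_j = 0] as well, against [noX]. *)
- move=> l j x [i /= cli Xix] xj lj; apply: noX; exists i, j; split; last by exists x.
  have : has (meets0 i) (enum 'I_n).
    by rewrite has_find size_enum_ord -/(cl i) cli lj.
  by move=> /(nth_find j); rewrite -/(cl i) cli lj nth_ord_enum => /asboolP.
have /boolp.choice[g gP] (l : 'I_n.+1) : exists i, cl i = l /\ X i x.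
  by have [i] := xY l; exists i.
(* Each index has one class, so the [n + 1] classes give distinct indices. *)
have g_inj : injective g.
  by move=> l m gE; apply/val_inj; rewrite /= -(gP l).1 -(gP m).1 gE.
have := X_mult x; rewrite leqNgt => /negP; apply.
rewrite -[X in (X <= _)%N](card_ord n.+1) -(card_codom g_inj).
apply/subset_leq_card/fintype.subsetP => _ /codomP[l ->].
by rewrite inE; case: (gP l).
Qed.
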